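(* Let $n\ge 2$, $\phi=\phi(z)$, $z=rK(\Theta)$, and let $\mathbf u(x,t)$ be any solution of $\mathbf u_t+(\phi\mathbf u)_x=\mathbf 0$ with bounded Riemann data $\mathbf u_\pm=r_\pm\Theta_\pm$ of the form $$\mathbf u(x,t)=(\hat r(x,t)+\varrho\,t\,\delta_\sigma)\big((1-\breve\delta_\sigma)\hat\Theta(x,t)+\breve\delta_\sigma\Theta_\sigma\big),$$ for which, with $K_\pm=K(\Theta_\pm)$, $$K\left(\frac{K_-\Theta_+-K_+\Theta_-}{|K_-\Theta_+-K_+\Theta_-|}\right)=0 .$$ Then $\mathbf u(x,t)$ satisfies the following balance law across $x=st$: $$\frac{d}{dt}\int_{st^-}^{st^+}\mathbf u(x,t)\,dx-s\,(\mathbf u_+-\mathbf u_-)+\big(\phi(z_+)\mathbf u_+-\phi(z_-)\mathbf u_-\big)=\mathbf 0,$$ where $$s=\frac{\phi(z_-)z_--\phi(z_+)z_+}{z_--z_+},\qquad z_\pm=r_\pm K_\pm .$$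
   Context: $\mathbf u=r\Theta$ with $r=|\mathbf u|$, $\Theta\in S^{n-1}$. Standing hypotheses: $K:S^{n-1}\to\mathbb R$ smooth and odd, $\phi:\mathbb R\to\mathbb R$ smooth with $\phi(0)=0$, $\phi_z>0$, $(\phi(z)z)_{zz}>0$; Riemann data $\mathbf u_-=r_-\Theta_-$ for $x<0$, $\mathbf u_+=r_+\Theta_+$ for $x>0$ with $r_\pm>0$, $K_->0>K_+$ and $\Theta_+\neq\pm\Theta_-$. Notation in the solution form: $\hat r(x,t)=r_--(r_--r_+)H(x-st)$, $\hat\Theta(x,t)=\Theta_--(\Theta_--\Theta_+)H(x-st)$, $H$ the unit step function; $\delta_\sigma=\delta(x-st)$ is the Dirac measure on the line $x=st$; $\breve\delta_\sigma=\breve\delta(x-st)$ with $\breve\delta(0)=1$ and $\breve\delta(x)=0$ for $x\ne0$; the product $\delta_\sigma\breve\delta_\sigma$ is the measure obtained by integrating the pointwise-defined function $\breve\delta_\sigma$ against $\delta_\sigma$, so $\int_{st^-}^{st^+}\delta_\sigma\breve\delta_\sigma\,dx=1$. Thus $\mathbf u(\cdot,t)$ equals $\mathbf u_-$ for $x<st$, $\mathbf u_+$ for $x>st$, plus the singular mass $\varrho\,t\,\Theta_\sigma$ at $x=st$. Here $\alpha_\pm=\pm(s-\phi(z_\pm))r_\pm$, $\varrho=|\alpha_+\Theta_++\alpha_-\Theta_-|$ and $\Theta_\sigma\in S^{n-1}$ satisfies $\varrho\,\Theta_\sigma=\alpha_+\Theta_++\alpha_-\Theta_-$. $\int_{st^-}^{st^+}$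 denotes the limit of the integral over shrinking intervals $(a,b)\ni st$ with $a\to st^-$, $b\to st^+$, i.e. the mass of the measure $\mathbf u(\cdot,t)$ at $x=st$. *)

(* Defs.v *)
From HB Require Import structures.
From mathcomp Require Import all_boot all_order all_algebra.
From mathcomp Require Import all_classical all_reals all_analysis.
Import Order.TTheory GRing.Theory Num.Theory.
Import numFieldNormedType.Exports.

Set Implicit Arguments.
Unset Strict Implicit.
Unset Printing Implicit Defensive.

Local Open Scope classical_set_scope.
Local Open Scope ring_scope.

(* The library norm on 'rV[R]_n is the sup norm, hence this one. *)
Definition enorm {R : realType} {n : nat} (v : 'rV[R]_n) : R :=
  Num.sqrt (\sum_i v 0 i ^+ 2).

(* S^{n-1} in R^n *)
Definition usphere {R : realType} {n : nat} : set 'rV[R]_n :=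
  [set v | enorm v = 1].

(* C^oo on an open set U of a finite-dimensional space: iterated directional
   derivatives of all orders exist and are continuous on U. *)
Definition smooth_on {R : realType} {V : normedModType R} (U : set V)
    (f : V -> R) : Prop :=
  forall (vs : seq V) (x : V), U x ->
    {for x, continuous (foldr (fun v g => 'D_v g) f vs)} /\
    (forall v, derivable (foldr (fun v g => 'D_v g) f vs) x v).

(* Smoothness on the embedded sphere: local smooth extensions to open subsets
   of R^n. Functions on the sphere are represented by total functions on
   'rV[R]_n whose values off the sphere are irrelevant. *)
Definition smooth_on_sphere {R : realType} {n : nat} (K : 'rV[R]_n -> R) :
    Prop :=
  forall v, usphere v -> exists (U : set 'rV[R]_n) (F : 'rV[R]_n -> R),
    [/\ open U, U v, smooth_on U F &
         forall w, U w -> usphere w -> F w = K w].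

Definition odd_on_sphere {R : realType} {n : nat} (K : 'rV[R]_n -> R) : Prop :=
  forall v, usphere v -> K (- v) = - K v.

Definition unit_step {R : realType} (x : R) : R := if 0 <= x then 1 else 0.

Definition breve_delta {R : realType} (x : R) : R := if x == 0 then 1 else 0.

Definition hat_r {R : realType} (s rm rp x t : R) : R :=
  rm - (rm - rp) * unit_step (x - s * t).

Definition hat_Theta {R : realType} {n : nat} (s : R) (Tm Tp : 'rV[R]_n)
    (x t : R) : 'rV[R]_n :=
  Tm - unit_step (x - s * t) *: (Tm - Tp).

(* A vector measure u(., t) = r Theta is given in polar form, by the positive
   measure r(., t) and the pointwise defined direction Theta(., t).
   [uint r Theta t A f] is the vector \int_A f(x) u(dx, t). *)
Definition uint {R : realType} {n : nat}
    (r : R -> {measure set (measurableTypeR R) -> \bar R})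
    (Theta : R -> R -> 'rV[R]_n) (t : R) (A : set R) (f : R -> R) : 'rV[R]_n :=
  \row_i (\int[r t]_(x in A) (f x * Theta x t 0 i)).

(* The product form
     (hat_r + rho t delta_sigma)
       ((1 - breve_delta_sigma) hat_Theta + breve_delta_sigma Theta_sigma). *)
Definition delta_shock_form {R : realType} {n : nat} (s rm rp rho : R)
    (Tm Tp Ts : 'rV[R]_n)
    (r : R -> {measure set (measurableTypeR R) -> \bar R})
    (Theta : R -> R -> 'rV[R]_n) : Prop :=
  forall t : R, 0 < t ->
    (forall A : set (measurableTypeR R), measurable A ->
       (r t A = \int[lebesgue_measure]_(x in A) (hat_r s rm rp x t)%:E
                + (rho * t)%:E * \d_(s * t)%R A)%E) /\
    (forall x, Theta x t =
       (1 - breve_delta (x - s * t)) *: hat_Theta s Tm Tp x t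
       + breve_delta (x - s * t) *: Ts).

(* z = r K(Theta) as measures in x: z(., t) is a pointwise representative of
   the density of K(Theta) r. Since r may charge points, such a z exists only
   if K(Theta) vanishes at the atoms of r; there the product is of the form
   oo * 0 and any value of z is admissible. *)
Definition z_of {R : realType} {n : nat} (K : 'rV[R]_n -> R)
    (r : R -> {measure set (measurableTypeR R) -> \bar R})
    (Theta : R -> R -> 'rV[R]_n) (z : R -> R -> R) : Prop :=
  [/\ measurable_fun setT (fun p : R * R => z p.1 p.2),
      exists M, forall x t, `|z x t| <= M &
      forall t a b : R, 0 < t -> a <= b ->
        \int[lebesgue_measure]_(x in `[a, b]) z x t =
        \int[r t]_(x in `[a, b]) K (Theta x t)].

Definition test_function {R : realType} (psi : R * R -> R) : Prop :=
  smooth_on setT psi /\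
  exists2 C : set (R * R), compact C & forall p, ~ C p -> psi p = 0.

(* Measure solutions, in the sense of distributions, of
   u_t + (phi(z) u)_x = 0, z = r K(Theta), with initial data u0. Points of
   R * R are (x, t); test functions need not vanish at t = 0. *)
Definition distributional_solution {R : realType} {n : nat} (phi : R -> R)
    (K : 'rV[R]_n -> R) (u0 : R -> 'rV[R]_n)
    (r : R -> {measure set (measurableTypeR R) -> \bar R})
    (Theta : R -> R -> 'rV[R]_n) : Prop :=
  exists2 z : R -> R -> R, z_of K r Theta z &
    forall psi : R * R -> R, test_function psi -> forall i : 'I_n,
      \int[lebesgue_measure]_(t in `]0, +oo[)
        (uint r Theta t setT (fun x =>
           'D_((0, 1) : R * R) psi (x, t)
           + phi (z x t) * 'D_((1, 0) : R * R) psi (x, t)) 0 i)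
      + \int[lebesgue_measure]_x (psi (x, 0) * u0 x 0 i) = 0.

Definition riemann_data {R : realType} {n : nat} (um up : 'rV[R]_n) (x : R) :
    'rV[R]_n := if x < 0 then um else up.

(* Integrals of u(., t) over shrinking intervals ]a, b[ around the point y,
   and their limit as a --> y^-, b --> y^+. *)
Definition shrinking_integral {R : realType} {n : nat}
    (r : R -> {measure set (measurableTypeR R) -> \bar R})
    (Theta : R -> R -> 'rV[R]_n) (y t : R) : set_system 'rV[R]_n :=
  uint r Theta t `]ab.1, ab.2[ (cst 1)
    @[ab --> filter_prod (at_left y) (at_right y)].

Definition mass_at {R : realType} {n : nat}
    (r : R -> {measure set (measurableTypeR R) -> \bar R})
    (Theta : R -> R -> 'rV[R]_n) (y t : R) : 'rV[R]_n :=
  lim (shrinking_integral r Theta y t).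

(* Main.v *)
Require Import Defs.
From HB Require Import structures.
From mathcomp Require Import all_boot all_order all_algebra.
From mathcomp Require Import all_classical all_reals all_analysis.
From mathcomp Require Import measurable_realfun ring.
Import Order.TTheory GRing.Theory Num.Theory.
Import numFieldNormedType.Exports.

Set Implicit Arguments.
Unset Strict Implicit.

Local Open Scope classical_set_scope.
Local Open Scope ring_scope.

(** In the product form of the solution everything is piecewise constant in
    [x] except for a single atom: at time [t > 0] the polar measure has density
    [rm] to the left of [s t], density [rp] to the right of it, and an atom of
    weight [rho t] at [s t], where the direction is [Ts].  Hence the integral
    of [u(., t)] over an interval [(a, b)] around [s t] is
    [rm (s t - a) Tm + rho t Ts + rp (b - s t) Tp] ([uint_across_shock]), and
    when the interval shrinks only the middle term is left: the mass carried by
    the shock is [t (rho Ts)] ([shrinking_integral_cvg]).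

    The mass is therefore linear in [t], with derivative
    [rho Ts = ap Tp + am Tm].  By the choice of [am] and [ap], this vector is
    [(s - phi zp) up - (s - phi zm) um], which is exactly the deficit
    [s (up - um) - (phi zp up - phi zm um)] in the Rankine-Hugoniot relation. *)

Lemma measurable_fun_eq_cst d (T : measurableType d) (R : realType)
    (D : set T) (f : T -> R) (c : R) :
  {in D, f =1 cst c} -> measurable_fun D f.
Proof.
move=> fc; apply: (eq_measurable_fun (cst c)); last exact: measurable_cst.
by move=> x xD; rewrite fc.
Qed.

Lemma integral_eq_cst d (T : measurableType d) (R : realType)
    (mu : {measure set T -> \bar R}) (D : set T) (f : T -> R) (c : R) :
  measurable D -> {in D, f =1 cst c} ->
  (\int[mu]_(x in D) (f x)%:E = c%:E * mu D)%E.
Proof.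
move=> mD fc; rewrite -integral_cst//; apply: eq_integral => x xD.
by rewrite fc.
Qed.

Lemma itv_oo_split (R : realType) (a y b : R) : a < y -> y < b ->
  `]a, b[%classic = (`]a, y[ `|` [set y]) `|` `]y, b[.
Proof.
move=> ay yb; apply/seteqP; split=> [x|x [[|->]|]] /=; rewrite ?in_itv /=.
- move=> /andP[ax xb]; case: (ltgtP x y) => xy.
  + by left; left; rewrite ax.
  + by right; rewrite xb.
  + by left; right.
- by move=> /andP[-> /lt_trans]; exact.
- by rewrite ay.
- by move=> /andP[yx ->]; rewrite (lt_trans ay).
Qed.

(** Against a measure that may charge [y], a function which is constant on each
    side of [y] sees the atom through its value at [y]. *)
Lemma Rintegral_across (R : realType)
    (mu : {measure set (measurableTypeR R) -> \bar R})
    (f : R -> R) (a y b ml m0 mr cl c0 cr : R) :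
  a < y -> y < b ->
  mu `]a, y[%classic = ml%:E -> mu [set y] = m0%:E ->
  mu `]y, b[%classic = mr%:E ->
  {in `]a, y[%classic, f =1 cst cl} -> f y = c0 ->
  {in `]y, b[%classic, f =1 cst cr} ->
  \int[mu]_(x in `]a, b[) f x = cl * ml + c0 * m0 + cr * mr.
Proof.
move=> ay yb mul mu0 mur fl f0 fr.
have f0' : {in [set y], f =1 cst c0} by move=> x /[!inE] ->.
have ml' : measurable (`]a, y[%classic : set (measurableTypeR R)) by [].
have m0' : measurable ([set y] : set (measurableTypeR R)) by [].
have mr' : measurable (`]y, b[%classic : set (measurableTypeR R)) by [].
have mf1 : measurable_fun (`]a, y[ `|` [set y] : set (measurableTypeR R)) f.
  apply/(measurable_funU f ml' m0').
  by split; [exact: measurable_fun_eq_cst fl|exact: measurable_fun_eq_cst f0'].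
have mlm0 : measurable (`]a, y[ `|` [set y] : set (measurableTypeR R)).
  exact: measurableU.
have mf : measurable_fun
    ((`]a, y[ `|` [set y]) `|` `]y, b[ : set (measurableTypeR R)) f.
  by apply/(measurable_funU f mlm0 mr'); split => //;
     exact: measurable_fun_eq_cst fr.
have dl0 : [disjoint `]a, y[ & [set y]]%classic.
  by apply/disj_setPS => x [] /[swap] ->; rewrite /= in_itv /= ltxx andbF.
have dr : [disjoint `]a, y[ `|` [set y] & `]y, b[]%classic.
  apply/disj_setPS => x [[|->]]; rewrite /= !in_itv /= ?ltxx//.
  by move=> /andP[_ xy] /andP[/(lt_trans xy)]; rewrite ltxx.
rewrite /Rintegral (itv_oo_split ay yb) integral_setU//; last first.
  exact/measurable_EFinP.
rewrite integral_setU//; last exact/measurable_EFinP.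
rewrite (integral_eq_cst mu ml' fl) (integral_eq_cst mu m0' f0').
by rewrite (integral_eq_cst mu mr' fr) mul mu0 mur.
Qed.

Section delta_shock.
Context (R : realType) (n : nat) (s rm rp rho : R) (Tm Tp Ts : 'rV[R]_n).
Context (r : R -> {measure set (measurableTypeR R) -> \bar R}).
Context (Theta : R -> R -> 'rV[R]_n).
Context (hform : delta_shock_form s rm rp rho Tm Tp Ts r Theta).

Lemma mass_left_of_shock (t a : R) : 0 < t -> a < s * t ->
  r t `]a, (s * t)[%classic = (rm * (s * t - a))%:E.
Proof.
move=> t0 ay; rewrite (hform t0).1//.
rewrite (@integral_eq_cst _ _ _ _ _ _ rm)//; last first.
  move=> x /[!inE]/=; rewrite in_itv /= => /andP[_ xy].
  by rewrite /hat_r /unit_step subr_ge0 leNgt xy mulr0 subr0.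
rewrite [X in (_ * X + _)%E]lebesgue_measure_itv /= lte_fin ay diracE.
rewrite memNset ?mule0 ?adde0//.
by rewrite /= in_itv /= ltxx andbF.
Qed.

Lemma mass_right_of_shock (t b : R) : 0 < t -> s * t < b ->
  r t `](s * t), b[%classic = (rp * (b - s * t))%:E.
Proof.
move=> t0 yb; rewrite (hform t0).1//.
rewrite (@integral_eq_cst _ _ _ _ _ _ rp)//; last first.
  move=> x /[!inE]/=; rewrite in_itv /= => /andP[yx _].
  by rewrite /hat_r /unit_step subr_ge0 ltW// mulr1 subKr.
rewrite [X in (_ * X + _)%E]lebesgue_measure_itv /= lte_fin yb diracE.
rewrite memNset ?mule0 ?adde0//.
by rewrite /= in_itv /= ltxx.
Qed.

Lemma mass_on_shock (t : R) : 0 < t -> r t [set (s * t)] = (rho * t)%:E.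
Proof.
by move=> t0; rewrite (hform t0).1// integral_set1 add0e diracE mem_set// mule1.
Qed.

Lemma uint_across_shock (t a b : R) : 0 < t -> a < s * t -> s * t < b ->
  uint r Theta t `]a, b[ (cst 1) =
  (rm * (s * t - a)) *: Tm + (rho * t) *: Ts + (rp * (b - s * t)) *: Tp.
Proof.
move=> t0 ay yb; apply/rowP => i; rewrite !mxE.
rewrite (@Rintegral_across _ _ _ _ _ _ _ _ _ (Tm 0 i) (Ts 0 i) (Tp 0 i) ay yb
  (mass_left_of_shock t0 ay) (mass_on_shock t0) (mass_right_of_shock t0 yb)).
- by congr (_ + _ + _); exact: mulrC.
- move=> x /[!inE]/=; rewrite in_itv /= => /andP[_ xy].
  rewrite mul1r (hform t0).2 /breve_delta subr_eq0 lt_eqF// /hat_Theta.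
  by rewrite /unit_step subr_ge0 leNgt xy !scale0r !subr0 scale1r addr0.
- rewrite mul1r (hform t0).2 /breve_delta subrr eqxx.
  by rewrite subrr scale0r add0r scale1r.
- move=> x /[!inE]/=; rewrite in_itv /= => /andP[yx _].
  rewrite mul1r (hform t0).2 /breve_delta subr_eq0 gt_eqF// /hat_Theta.
  by rewrite /unit_step subr_ge0 ltW// scale0r subr0 !scale1r addr0 subKr.
Qed.

(** The regular part of [u(., t)] has bounded density, so that its mass vanishes
    with the length of the interval and only the atom survives. *)
Lemma shrinking_integral_cvg (t : R) : 0 < t ->
  shrinking_integral r Theta (s * t) t --> (rho * t) *: Ts.
Proof.
move=> t0; rewrite /shrinking_integral; set F := filter_prod _ _.
have FF : Filter F by exact: filter_prod_filter.
have lt1 : \forall ab \near F, ab.1 < s * t.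
  exact: (@cvg_fst _ _ (at_left (s * t)) (at_right (s * t)) _ _
    (nbhs_left_lt (s * t))).
have gt2 : \forall ab \near F, s * t < ab.2.
  exact: (@cvg_snd _ _ (at_left (s * t)) (at_right (s * t)) _ _
    (nbhs_right_gt (s * t))).
have cvg1 : ab.1 @[ab --> F] --> s * t.
  exact: (cvg_trans cvg_fst (cvg_within _)).
have cvg2 : ab.2 @[ab --> F] --> s * t.
  exact: (cvg_trans cvg_snd (cvg_within _)).
have : (rm * (s * t - ab.1)) *: Tm + (rho * t) *: Ts
    + (rp * (ab.2 - s * t)) *: Tp @[ab --> F] --> (rho * t) *: Ts; last first.
  apply: cvg_trans; apply: near_eq_cvg; near=> ab; rewrite uint_across_shock//.
  - by near: ab; exact: lt1.
  - by near: ab; exact: gt2.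
have lin c (g : R * R -> R) (v : 'rV[R]_n) :
    g ab @[ab --> F] --> 0 -> (c * g ab) *: v @[ab --> F] --> (0 : 'rV[R]_n).
  move=> g0; rewrite -(scale0r v) -(mulr0 c).
  exact: (cvgZr_tmp (cvgM (cvg_cst c) g0)).
have cvgl : (rm * (s * t - ab.1)) *: Tm @[ab --> F] --> (0 : 'rV[R]_n).
  apply: (lin rm (fun ab => s * t - ab.1)).
  by rewrite -(subrr (s * t)); exact: (cvgB (cvg_cst _) cvg1).
have cvgr : (rp * (ab.2 - s * t)) *: Tp @[ab --> F] --> (0 : 'rV[R]_n).
  apply: (lin rp (fun ab => ab.2 - s * t)).
  by rewrite -(subrr (s * t)); exact: (cvgB cvg2 (cvg_cst _)).
have := cvgD (cvgD cvgl (cvg_cst ((rho * t) *: Ts))) cvgr.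
by rewrite add0r addr0; exact.
Unshelve. all: by end_near.
Qed.

Lemma mass_at_shock (t : R) : 0 < t ->
  mass_at r Theta (s * t) t = (rho * t) *: Ts.
Proof. by move=> t0; apply/cvg_lim => //; exact: shrinking_integral_cvg. Qed.

(** The formula for the mass is available for positive times only, so it gives
    the derivative locally around [t]. *)
Lemma is_derive_mass_at_shock (t : R) : 0 < t ->
  is_derive t 1 (fun t => mass_at r Theta (s * t) t) (rho *: Ts).
Proof.
move=> t0.
have linD : is_derive t (1 : R) (fun x : R => x *: (rho *: Ts)) (rho *: Ts).
  have [df dE] := is_diff_scalel t (rho *: Ts).
  split; first exact: diff_derivable.
  by rewrite deriveE// dE scale1r.
apply: near_eq_is_derive linD; near=> x.
rewrite mass_at_shock; first by rewrite scalerA mulrC.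
by near: x; exact: lt_nbhsr.
Unshelve. all: by end_near.
Qed.

End delta_shock.

Unset Implicit Arguments.

Theorem theorem5p32 (R : realType) (n : nat) (hn : (2 <= n)%N)
  (K : 'rV[R]_n -> R) (phi : R -> R)
  (rm rp : R) (Tm Tp : 'rV[R]_n)
  (Km Kp zm zp s am ap rho : R) (Ts um up : 'rV[R]_n)
  (r : R -> {measure set (measurableTypeR R) -> \bar R})
  (Theta : R -> R -> 'rV[R]_n)
  (hK : smooth_on_sphere K) (hKodd : odd_on_sphere K)
  (hphi : smooth_on setT phi) (hphi0 : phi 0 = 0)
  (hphi1 : forall z, 0 < (phi^`())%classic z)
  (hphi2 : forall z, 0 < ((fun y => phi y * y)^`(2))%classic z)
  (hrm : 0 < rm) (hrp : 0 < rp)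
  (hTm : usphere Tm) (hTp : usphere Tp)
  (hTT : Tp <> Tm) (hTNT : Tp <> - Tm)
  (hKm : Km = K Tm) (hKp : Kp = K Tp) (hKm0 : 0 < Km) (hKp0 : Kp < 0)
  (hzm : zm = rm * Km) (hzp : zp = rp * Kp)
  (hum : um = rm *: Tm) (hup : up = rp *: Tp)
  (hs : s = (phi zm * zm - phi zp * zp) / (zm - zp))
  (ham : am = - ((s - phi zm) * rm)) (hap : ap = (s - phi zp) * rp)
  (hrho : rho = enorm (ap *: Tp + am *: Tm))
  (hTs : usphere Ts) (hrhoTs : rho *: Ts = ap *: Tp + am *: Tm)
  (hform : delta_shock_form s rm rp rho Tm Tp Ts r Theta)
  (hsol : distributional_solution phi K (riemann_data um up) r Theta)
  (hKs : K ((enorm (Km *: Tp - Kp *: Tm))^-1 *: (Km *: Tp - Kp *: Tm)) = 0) :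
  forall t : R, 0 < t ->
    [/\ cvg (shrinking_integral r Theta (s * t) t),
        derivable (fun t => mass_at r Theta (s * t) t) t 1 &
        ((fun t => mass_at r Theta (s * t) t)^`())%classic t - s *: (up - um)
          + (phi zp *: up - phi zm *: um) = 0].
Proof.
move=> t t0.
have [dmass massE] := is_derive_mass_at_shock hform t0.
split; last 1 first.
- rewrite derive1E massE hrhoTs ham hap hum hup.
  by apply/rowP => i; rewrite !mxE; ring.
- by apply/cvg_ex; eexists; exact: shrinking_integral_cvg hform _ t0.
- exact: dmass.
Qed.
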